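(* Let $G$ be a simple $r$-regular graph and let $f$ be a perfect $(b,c)$-coloring of $G$. Assume that there are vertices $u,v\in V(G)$ of different colors such that $|\mathcal N(u)\cap\mathcal N(v)|=h$. Then $$h\le b+c\le 2r-h.$$ If $b+c=h$, then all vertices of $\mathcal N(u)\setminus\mathcal N(v)$ have the same color as $u$, and all vertices of $\mathcal N(v)\setminus\mathcal N(u)$ have the same color as $v$. If $b+c=2r-h$, then all vertices of $\mathcal N(u)\setminus\mathcal N(v)$ have the same color as $v$, and all vertices of $\mathcal N(v)\setminus\mathcal N(u)$ have the same color as $u$. Finally, if the vertices $u$ and $v$ are adjacent, then $h+2\le b+c$.
   Context: A simple graph is undirected, without loops or multiple edges. $\mathcal N(v)$ is the set of vertices adjacent to $v$. A perfect $(b,c)$-coloring of an $r$-regular graph $G$ is a coloring $f:V(G)\to\{1,2\}$ with parameter matrix $S=\begin{pmatrix}a&b\\c&d\end{pmatrix}$, where $a+b=c+d=r$: every vertex of color $1$ has exactly $a$ neighbors of color $1$ and $b$ neighbors of color $2$, and every vertex of color $2$ has exactly $c$ neighbors of color $1$ and $d$ neighbors of color $2$. *)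

(* Defs.v *)
From mathcomp Require Import all_boot all_algebra.
From mathcomp Require Import boolp classical_sets functions cardinality.

Set Implicit Arguments.
Unset Strict Implicit.
Unset Printing Implicit Defensive.

Local Open Scope classical_set_scope.
Local Open Scope card_scope.

(* The vertex type is arbitrary, so infinite graphs are allowed. *)
Record sgraph := SGraph {
  vertex :> Type;
  adj : vertex -> vertex -> Prop;
  adj_sym : forall x y, adj x y -> adj y x;
  adj_irrefl : forall x, ~ adj x x }.

Definition nbhd (G : sgraph) (v : G) : set G := [set w | adj v w].

(* [A #= `I_n] means that A is in bijection with {0, ..., n-1}, i.e. that A is
   finite with exactly n elements. *)
Definition has_card (T : Type) (A : set T) (n : nat) : Prop := A #= `I_n.

Definition regular (G : sgraph) (r : nat) : Prop :=
  forall v : G, has_card (nbhd v) r.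

Definition perfect_coloring (G : sgraph) (k : nat) (f : G -> 'I_k)
    (S : 'M[nat]_k) : Prop :=
  forall (v : G) (j : 'I_k),
    has_card [set w | nbhd v w /\ f w = j] (S (f v) j).

(* The colors 1 and 2 are the elements 0 and 1 of 'I_2. *)
Definition matrix2 (a b c d : nat) : 'M[nat]_2 :=
  \matrix_(i < 2, j < 2)
    if i == ord0 then (if j == ord0 then a else b)
    else (if j == ord0 then c else d).

Definition perfect_bc_coloring (G : sgraph) (r b c : nat) (f : G -> 'I_2) : Prop :=
  exists a d : nat,
    [/\ a + b = r, c + d = r & perfect_coloring f (matrix2 a b c d)].

(* Main.v *)
(* For a vertex set A and a colour k, let A_k be its part of colour k.  With
   i = f u, j = f v and C = N(u) ∩ N(v), counting N(u)_j and N(v)_i gives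
   b + c = |C_j| + |(N(u) \ N(v))_j| + |C_i| + |(N(v) \ N(u))_i|, so
   b + c = h + |(N(u) \ N(v))_j| + |(N(v) \ N(u))_i|.  Likewise
   2r - (b + c) = h + |(N(u) \ N(v))_i| + |(N(v) \ N(u))_j|.  If u and v are
   adjacent, then v and u lie in the two sets of the first identity. *)
Require Import Defs.
From mathcomp Require Import all_boot all_algebra.
From mathcomp Require Import boolp classical_sets functions cardinality.
From mathcomp Require Import finmap zify.

Set Implicit Arguments.
Unset Strict Implicit.

Local Open Scope classical_set_scope.

(* [fset_set] needs a choiceType, which [{classic T}] provides.  The value is 0
   on infinite sets. *)
Definition ncard (T : Type) (A : set T) : nat :=
  #|` fset_set (A : set {classic T})|%fset.

Lemma has_card_finite (T : Type) (A : set T) (n : nat) :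
  has_card A n -> finite_set A.
Proof. by move=> An; exists n. Qed.

Lemma has_card_ncard (T : Type) (A : set T) (n : nat) :
  has_card A n -> ncard A = n.
Proof. exact: (@card_fset_set {classic T}). Qed.

Lemma ncardID (T : Type) (B A : set T) :
  finite_set A -> ncard A = ncard (A `&` B) + ncard (A `\` B).
Proof.
move=> finA; have finA' : finite_set (A : set {classic T}) by [].
have finAB : finite_set (A `&` B : set {classic T}) by apply: finite_setIl.
(* [B] may be infinite, and [fset_setD] needs both sets finite, so [A] minus [B] is first rewritten
   as [A] minus its finite part inside [B]. *)
rewrite /ncard (_ : A `\` B = A `\` (A `&` B)); last first.
  apply/seteqP; split=> x /= [Ax nB]; split=> //; first by case.
  by move=> Bx; apply: nB.
rewrite (@fset_setD {classic T} A (A `&` B)) //.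
rewrite -(cardfsID (fset_set (A `&` B : set {classic T}))
  (fset_set (A : set {classic T}))).
congr (#|` _ | + _)%N; apply/fsetIidPr.
by rewrite -fset_set_sub //; apply: subIsetl.
Qed.

Lemma ncard_gt0 (T : Type) (A : set T) (x : T) :
  finite_set A -> A x -> 0 < ncard A.
Proof.
move=> finA Ax; have finA' : finite_set (A : set {classic T}) by [].
rewrite /ncard cardfs_gt0; apply/fset0Pn; exists (x : {classic T}).
by rewrite in_fset_set //; apply/mem_set.
Qed.

Lemma ord2_third (i j k : 'I_2) : i <> j -> k <> i -> k = j.
Proof.
move=> ij ki; apply: val_inj => /=.
have {}ij : val i <> val j by move=> /val_inj.
have {}ki : val k <> val i by move=> /val_inj.
by have := ltn_ord i; have := ltn_ord j; have := ltn_ord k; move: ij ki => /=; lia.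
Qed.

(** The sum is symmetric in the two colors, so it never matters which of [u] and [v] has color 1. *)
Lemma matrix2_offdiag (a b c d : nat) (i j : 'I_2) :
  i <> j -> matrix2 a b c d i j + matrix2 a b c d j i = b + c.
Proof.
case: i j => [[|[|//]] ?] [[|[|//]] ?] ij; rewrite !mxE /=;
  first [by case: ij; apply: val_inj | by rewrite addnC | by []].
Qed.

Lemma matrix2_diag (a b c d : nat) (i j : 'I_2) :
  i <> j -> matrix2 a b c d i i + matrix2 a b c d j j = a + d.
Proof.
case: i j => [[|[|//]] ?] [[|[|//]] ?] ij; rewrite !mxE /=;
  first [by case: ij; apply: val_inj | by rewrite addnC | by []].
Qed.

Lemma ncard_two_colors (T : Type) (f : T -> 'I_2) (A : set T) (i j : 'I_2) :
  i <> j -> finite_set A ->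
  ncard A = ncard (A `&` [set w | f w = i]) + ncard (A `&` [set w | f w = j]).
Proof.
move=> ij finA; rewrite (ncardID [set w | f w = i]) //.
congr (_ + ncard _); apply/seteqP; split=> w /= [Aw fw]; split=> //.
  exact: ord2_third fw.
by rewrite fw => /esym.
Qed.

Lemma ncard_color_split (T : Type) (f : T -> 'I_2) (A B : set T) (k : 'I_2) :
  finite_set A -> ncard (A `&` [set w | f w = k]) =
  ncard (A `&` B `&` [set w | f w = k]) +
  ncard ((A `\` B) `&` [set w | f w = k]).
Proof.
move=> finA; rewrite (ncardID B); last exact: finite_setIl.
by rewrite setIAC !setDE [in X in _ + X]setIAC.
Qed.

Unset Implicit Arguments.
Set Strict Implicit.

Theorem theorem3 (G : sgraph) (r b c : nat) (f : G -> 'I_2)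
    (Greg : regular G r) (fperf : perfect_bc_coloring r b c f)
    (u v : G) (h : nat) (fuv : f u <> f v)
    (huv : has_card (nbhd u `&` nbhd v) h) :
  (h <= b + c <= 2 * r - h) /\
  (b + c = h ->
     (forall w : G, (nbhd u `\` nbhd v) w -> f w = f u) /\
     (forall w : G, (nbhd v `\` nbhd u) w -> f w = f v)) /\
  (b + c = 2 * r - h ->
     (forall w : G, (nbhd u `\` nbhd v) w -> f w = f v) /\
     (forall w : G, (nbhd v `\` nbhd u) w -> f w = f u)) /\
  (adj u v -> h + 2 <= b + c).
Proof.
have fin w : finite_set (nbhd w) := has_card_finite (Greg w).
case: fperf => a [d [abr cdr fS]].
have deg w k : matrix2 a b c d (f w) k = ncard (nbhd w `&` [set x | f x = k]).
  by rewrite (has_card_ncard (fS w k)).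
pose D x y k := ncard ((nbhd x `\` nbhd y) `&` [set w | f w = k]).
have D_gt0 x y w : (nbhd x `\` nbhd y) w -> 0 < D x y (f w).
  move=> xyw; apply: (@ncard_gt0 _ _ w); last by [].
  by apply: finite_setIl; apply: finite_setD.
(* With two colors only, a vertex not colored [i] is colored [j] and would be counted by
   [D x y j]. *)
have Dcolor x y w i j : i <> j -> (nbhd x `\` nbhd y) w -> D x y j = 0 ->
    f w = i.
  move=> ij xyw D0; apply: (@ord2_third j) => [/esym //|fw].
  by have := D_gt0 _ _ _ xyw; rewrite fw D0.
have hE := ncard_two_colors f fuv (has_card_finite huv).
rewrite (has_card_ncard huv) in hE.
have bcE : b + c = h + (D u v (f v) + D v u (f u)).
  rewrite -(matrix2_offdiag a b c d fuv) !deg hE.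
  rewrite (ncard_color_split f (nbhd v) _ (fin u)).
  by rewrite (ncard_color_split f (nbhd u) _ (fin v)) (setIC (nbhd v)) /D; lia.
(* As [a + b = c + d = r], the left side is 2r - (b + c). *)
have adE : a + d = h + (D u v (f u) + D v u (f v)).
  rewrite -(matrix2_diag a b c d fuv) !deg hE.
  rewrite (ncard_color_split f (nbhd v) _ (fin u)).
  by rewrite (ncard_color_split f (nbhd u) _ (fin v)) (setIC (nbhd v)) /D; lia.
have fvu : f v <> f u by move=> /esym.
(* The lower bound comes from [bcE], the upper one from [adE]. The latter also gives [h <= 2 * r],
   so the truncated subtraction is exact. *)
split; [lia | split; [|split]].
(* Here [bcE] forces both of its [D] terms to vanish; in the next case [adE] does the same for its
   own two. *)
- by move=> bch; split=> w uvw; [apply: (Dcolor u v) fuv uvw _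
                               | apply: (Dcolor v u) fvu uvw _]; lia.
- by move=> bch; split=> w uvw; [apply: (Dcolor u v) fvu uvw _
                               | apply: (Dcolor v u) fuv uvw _]; lia.
- move=> uv.
  (* The witness [v] is read off the color [f v]; having no loop, it lies outside its own
     neighborhood. The witness [u] below is symmetric. *)
  have : 0 < D u v (f v) by apply: D_gt0; split=> //; apply: adj_irrefl.
  have : 0 < D v u (f u).
    by apply: D_gt0; split; [apply: adj_sym | apply: adj_irrefl].
  lia.
Qed.
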